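(* Let $\sigma$ be a partition of a positive integer $r$ with smallest part $\delta$, let $n,q$ be positive integers, let $H=H(n,r,q\mid\sigma)$, and let $\beta$ be an integer with $2 \leq s(\sigma) \leq \beta$ and $\delta \geq r-\beta + 1$. Then the $(2,\beta)$-spectrum of $H$ has no gaps: there are no integers $k_1<k_2<k_3$ such that $H$ has a $k_1$-$(2,\beta)$-colouring and a $k_3$-$(2,\beta)$-colouring but no $k_2$-$(2,\beta)$-colouring.
   Context: For a partition $\sigma$ of $r$ and positive integers $n,q$, the $\sigma$-hypergraph $H(n,r,q\mid\sigma)$ is the $r$-uniform hypergraph whose vertex set has $nq$ vertices partitioned into $n$ classes $V_1,\dots,V_n$ of $q$ vertices each, and in which an $r$-subset $K$ of the vertex set is an edge if and only if the multiset of non-zero cardinalities $|K\cap V_i|$, $1\le i\le n$, is exactly the partition $\sigma$. $s(\sigma)$ denotes the number of parts of $\sigma$ and $\delta$ its smallest part. A $(2,\beta)$-colouring is an assignment of colours to the vertices such that every edge contains at least $2$ and at most $\beta$ distinct colours; a $k$-$(2,\beta)$-colouring is one using exactly $k$ colours. The $(2,\beta)$-spectrum is the set of $k$ for which a $k$-$(2,\beta)$-colouring exists. *)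

(* Defs.v *)
From mathcomp Require Import all_boot.

Set Implicit Arguments.
Unset Strict Implicit.
Unset Printing Implicit Defensive.

(* Parts are listed in nonincreasing order. *)
Definition is_partition (sigma : seq nat) (r : nat) : bool :=
  [&& sorted geq sigma, all (ltn 0) sigma & sumn sigma == r].

Definition num_parts (sigma : seq nat) : nat := size sigma.

Definition smallest_part (sigma : seq nat) : nat := last 0 sigma.

(* The pair (i, j) is the j-th vertex of the i-th class. *)
Definition vertex (n q : nat) : finType := ('I_n * 'I_q)%type.

Definition vclass (n q : nat) (i : 'I_n) : {set vertex n q} :=
  [set x : vertex n q | x.1 == i].

Definition class_sizes (n q : nat) (K : {set vertex n q}) : seq nat :=
  [seq #|K :&: vclass q i| | i <- enum 'I_n].

(* A hypergraph is given by its set of edges. *)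
Definition sigma_hypergraph (n r q : nat) (sigma : seq nat) :
    {set {set vertex n q}} :=
  [set K : {set vertex n q} |
    (#|K| == r) && perm_eq [seq c <- class_sizes K | c != 0] sigma].

(* f @: K is the set of colours that occur on K. *)
Definition coloring2 (V C : finType) (H : {set {set V}}) (beta : nat)
    (f : V -> C) : Prop :=
  forall K : {set V}, K \in H -> 2 <= #|f @: K| <= beta.

(* The palette C is arbitrary; only the colours actually used are counted. *)
Definition has_k_coloring2 (V : finType) (H : {set {set V}})
    (beta k : nat) : Prop :=
  exists (C : finType) (f : V -> C),
    coloring2 H beta f /\ #|f @: [set: V]| = k.

Definition spectrum2 (V : finType) (H : {set {set V}}) (beta : nat) :
    nat -> Prop :=
  fun k => has_k_coloring2 H beta k.

Definition no_gaps (S : nat -> Prop) : Prop :=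
  ~ exists k1 k2 k3 : nat, [/\ k1 < k2, k2 < k3, S k1, S k3 & ~ S k2].

(* Main.v *)
(* An edge that is monochromatic on some class it meets has at most
   1 + (r - delta) <= beta colours, so only the edges that are non-monochromatic
   on each class they meet can violate the upper bound.

   Up to n colours: starting from a colouring with k1 colours, give the classes,
   one after the other, a single private colour each.  Every step keeps the
   colouring valid and adds at most one colour, and the last colouring uses n
   colours, so all values between k1 and n occur.

   From n colours on: let R contain one vertex of each colour of a colouring f
   with k3 colours, and enlarge R by one vertex of each class that it misses.
   Between a transversal of the classes and this set choose T with k elements,
   and colour the vertices by a retraction onto T that preserves the classes.
   If an edge K is non-monochromatic on each class it meets, its image lies
   in R, where f is injective, and K can be moved inside the classes to an edge
   containing this image; so K has at most beta colours because f is valid. *)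
Require Import Defs.
From mathcomp Require Import all_boot.
From mathcomp Require Import zify.

Set Implicit Arguments.
Unset Strict Implicit.
Unset Printing Implicit Defensive.

Lemma intermediate_set (T : finType) (A B : {set T}) (k : nat) :
  A \subset B -> #|A| <= k <= #|B| ->
  exists C : {set T}, [/\ A \subset C, C \subset B & #|C| = k].
Proof.
move=> sAB; elim: k => [|k IHk] /andP[leAk lekB].
  by exists A; split=> //; apply/eqP; rewrite -leqn0.
move: leAk; rewrite leq_eqVlt => /predU1P[<-|ltAk]; first by exists A.
have [|C [sAC sCB cardC]] := IHk; first by rewrite -ltnS ltAk ltnW.
have /properP[_ [x Bx Cx]] : C \proper B by rewrite properEcard sCB cardC.
exists (x |: C); split; last by rewrite cardsU1 Cx cardC.
  exact: subset_trans sAC (subsetUr _ _).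
by rewrite subUset sub1set Bx.
Qed.

(** Only upward jumps are bounded, and that suffices: [h] equals [k] at the first [t] with
    [k <= h t]. *)
Lemma discrete_ivt (h : nat -> nat) (m k : nat) :
  (forall t, h t.+1 <= (h t).+1) -> h 0 <= k <= h m -> exists t, h t = k.
Proof.
move=> stepP; elim: m => [|m IHm] /andP[h0k khm].
  by exists 0; apply/eqP; rewrite eqn_leq h0k.
have [|lthk] := leqP k (h m); first by move=> khm'; apply: IHm; rewrite h0k.
exists m.+1; apply/eqP; rewrite eqn_leq khm andbT.
exact: leq_trans (stepP m) lthk.
Qed.

Lemma sorted_geq_last (s : seq nat) (c : nat) :
  sorted geq s -> c \in s -> last 0 s <= c.
Proof.
case/lastP: s => // s x; rewrite last_rcons mem_rcons inE.
rewrite (sorted_pairwise (fun _ _ _ h1 h2 => leq_trans h2 h1)) pairwise_rcons.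
by case/andP=> /allP le_x _ /predU1P[->|/le_x].
Qed.

Section SigmaHypergraph.

Variables (n r q : nat) (sigma : seq nat).
Implicit Types (K : {set vertex n q}) (x y : vertex n q).

Let H := sigma_hypergraph n r q sigma.

Lemma in_vclass x i : (x \in vclass q i) = (x.1 == i).
Proof. by rewrite inE. Qed.

Lemma card_class_sizes K : #|K| = sumn (class_sizes K).
Proof.
rewrite sumnE big_map big_enum /= -sum1_card.
rewrite (partition_big (fun x => x.1) predT) //=.
by apply: eq_bigr => i _; rewrite -sum1_card; apply: eq_bigl => x; rewrite !inE.
Qed.

Lemma edge_card K : K \in H -> #|K| = r.
Proof. by rewrite inE => /andP[/eqP]. Qed.

(** At least two classes meet [K], so one of them is not the class of [x]; [x] itself may lie
    outside [K]. *)
Lemma edge_two_classes K :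
  1 < size sigma -> K \in H ->
  forall x, exists2 y, y \in K & y.1 != x.1.
Proof.
move=> s_gt1; rewrite inE => /andP[_ /perm_size def_s] x.
move: s_gt1; rewrite -def_s size_filter count_map.
rewrite -sum1_count big_enum_cond /= sum1_card => /card_gt1P[i [j [Hi Hj ij]]].
have inK k : #|K :&: vclass q k| != 0 -> exists2 y, y \in K & y.1 = k.
  rewrite cards_eq0 => /set0Pn[y]; rewrite inE in_vclass => /andP[Ky /eqP].
  by exists y.
have [xi|xi] := eqVneq i x.1; last first.
  by have [y Ky yi] := inK _ Hi; exists y; rewrite // yi.
by have [y Ky yj] := inK _ Hj; exists y; rewrite // yj -xi eq_sym.
Qed.

Lemma edge_class_ge K x :
  is_partition sigma r -> K \in H -> x \in K ->
  smallest_part sigma <= #|K :&: vclass q x.1|.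
Proof.
case/and3P=> srt _ _; rewrite inE => /andP[_ eqs] Kx.
apply: sorted_geq_last => //; rewrite -(perm_mem eqs) mem_filter.
rewrite map_f ?mem_enum // andbT cards_eq0; apply/set0Pn.
by exists x; rewrite inE Kx in_vclass eqxx.
Qed.

Lemma eq_class_sizes_edge K K' :
  (forall i, #|K' :&: vclass q i| = #|K :&: vclass q i|) ->
  K \in H -> K' \in H.
Proof.
move=> eqK; have eqs : class_sizes K' = class_sizes K by apply: eq_map.
by rewrite !inE !card_class_sizes eqs.
Qed.

Lemma edge_mono_class_le (C : finType) (g : vertex n q -> C) (c : C) beta K x :
  is_partition sigma r -> r + 1 <= smallest_part sigma + beta ->
  K \in H -> x \in K -> {in K :&: vclass q x.1, forall y, g y = c} ->
  #|g @: K| <= beta.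
Proof.
move=> sigP delta_ge HK Kx gc.
have sub : g @: K \subset c |: g @: (K :\: vclass q x.1).
  apply/subsetP=> _ /imsetP[y Ky ->]; rewrite !inE.
  have [yx|yx] := boolP (y \in vclass q x.1).
    by rewrite gc ?eqxx // inE Ky.
  by rewrite imset_f ?orbT // inE yx.
have le1 := leq_trans (subset_leq_card sub) (leq_card_setU _ _).
rewrite cards1 in le1.
have le2 : #|g @: (K :\: vclass q x.1)| <= #|K :\: vclass q x.1|.
  exact: leq_imset_card.
have := edge_class_ge sigP HK Kx; have := cardsID (vclass q x.1) K.
rewrite (edge_card HK) => def_r le_d.
lia.
Qed.

(** An edge that meets a recoloured class is monochromatic there, and its vertices in other classes
    never have that private colour. All other edges keep their colours under [f]. *)
Lemma coloring2_privatize (C : finType) (f : vertex n q -> C) beta t :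
  is_partition sigma r -> 1 < size sigma ->
  r + 1 <= smallest_part sigma + beta -> coloring2 H beta f ->
  coloring2 H beta (fun x => if x.1 < t then inr x.1 else inl (f x)).
Proof.
move=> sigP s_gt1 delta_ge fP K HK; set g := fun x => _.
have [/exists_inP[x Kx xt]|] := boolP [exists x in K, x.1 < t]; last first.
  rewrite negb_exists_in => /forall_inP gP.
  have -> : g @: K = [set inl c | c in f @: K].
    rewrite -imset_comp; apply: eq_in_imset => x /gP.
    by rewrite /g /= => /negbTE->.
  by rewrite card_imset; [apply: fP | move=> c d []].
apply/andP; split; last first.
  apply: (@edge_mono_class_le _ g (inr x.1) beta K x) => // y.
  by rewrite inE in_vclass /g => /andP[_ /eqP->]; rewrite xt.
have [y Ky yx] := edge_two_classes s_gt1 HK x.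
apply/card_gt1P; exists (g y), (g x); split; try exact: imset_f.
by rewrite /g xt; case: ifP => _ //; apply: contra_neq yx => -[->].
Qed.

Lemma spectrum2_le_classes k1 k beta :
  0 < q -> is_partition sigma r -> 1 < size sigma ->
  r + 1 <= smallest_part sigma + beta ->
  spectrum2 H beta k1 -> k1 <= k <= n -> spectrum2 H beta k.
Proof.
move=> q_gt0 sigP s_gt1 delta_ge [C [f [fP def_k1]]] k1kn.
pose g t x : C + 'I_n := if x.1 < t then inr x.1 else inl (f x).
pose h t := #|g t @: [set: vertex n q]|.
have [||t ht] := @discrete_ivt h n k.
(* Passing from [t] to [t.+1] can add only the private colour of class [t]; for [t >= n] nothing
   changes. *)
- move=> t; have [lt_tn|le_nt] := ltnP t n; last first.
    rewrite /h (_ : _ @: _ = g t @: setT) //; apply: eq_imset => x.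
    by rewrite /g ltnS ltnW ?(leq_trans (ltn_ord _)).
  have sub : g t.+1 @: setT \subset inr (Ordinal lt_tn) |: g t @: setT.
    apply/subsetP=> _ /imsetP[x _ ->]; rewrite !inE.
    have [xt|xt] := eqVneq (x.1 : nat) t.
      rewrite /g xt leqnn; apply/orP; left; apply/eqP; congr inr.
      exact: val_inj.
    suff -> : g t.+1 x = g t x by rewrite imset_f ?orbT.
    by rewrite /g ltnS leq_eqVlt (negbTE xt).
  apply: leq_trans (subset_leq_card sub) _.
  by apply: leq_trans (leq_card_setU _ _) _; rewrite cards1.
- have -> : h 0 = k1.
    rewrite /h (_ : _ @: _ = [set inl c | c in f @: setT]).
      by rewrite card_imset // => c d [].
    by rewrite -imset_comp; apply: eq_imset.
  case/andP: k1kn => -> /leq_trans-> //.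
  (* At [t = n] every private colour occurs, since [q_gt0] provides a vertex in each class. *)
  rewrite -[X in X <= _](card_ord n) -(card_imset _ (@inr_inj C 'I_n)).
  apply/subset_leq_card/subsetP=> _ /imsetP[i _ ->]; apply/imsetP.
  by exists (i, Ordinal q_gt0); rewrite // /g ltn_ord.
by exists _, (g t); split=> //; apply: coloring2_privatize.
Qed.

(** Being an edge depends only on the class sizes, so [D] can be enlarged inside each class to the
    size that [K] has there. *)
Lemma edge_cover K (D : {set vertex n q}) :
  K \in H -> (forall i, #|D :&: vclass q i| <= #|K :&: vclass q i|) ->
  exists2 K', K' \in H & D \subset K'.
Proof.
move=> HK leDK.
have /fin_all_exists[F FP] i : exists B : {set vertex n q},
    [/\ D :&: vclass q i \subset B, B \subset vclass q i
      & #|B| = #|K :&: vclass q i|].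
  apply: intermediate_set; first exact: subsetIr.
  by rewrite leDK subset_leq_card ?subsetIr.
exists (\bigcup_i F i); last first.
  apply/subsetP=> x Dx; apply/bigcupP; exists x.1 => //.
  by have [/subsetP-> //] := FP x.1; rewrite inE Dx in_vclass /=.
apply: eq_class_sizes_edge HK => i; have [_ sFi <-] := FP i.
congr #|pred_of_set _|; apply/setP=> x; rewrite inE in_vclass.
apply/andP/idP=> [[/bigcupP[j _ Fjx]] /eqP <-|Fix].
  have [_ /subsetP/(_ x Fjx)] := FP j.
  by rewrite in_vclass => /eqP->.
split; first by apply/bigcupP; exists i.
by rewrite -in_vclass (subsetP sFi).
Qed.

Lemma imset_representatives (V C : finType) (f : V -> C) :
  exists R : {set V}, {in R &, injective f} /\ #|R| = #|f @: setT|.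
Proof.
(* The value [None] serves the colours of [C] that [f] never takes. *)
have /fin_all_exists[g gP] c : exists o : option V,
    if o is Some x then f x = c else c \notin f @: setT.
  have [/imsetP[x _ ->]|nc] := boolP (c \in f @: setT); first by exists (Some x).
  by exists None.
exists [set x | g (f x) == Some x]; split.
  by move=> x y; rewrite !inE => /eqP gx /eqP gy fxy; move: gx; rewrite fxy gy => -[].
rewrite -(@card_in_imset _ _ f); last first.
  by move=> x y; rewrite !inE => /eqP gx /eqP gy fxy; move: gx; rewrite fxy gy => -[].
congr #|pred_of_set _|; apply/setP=> c; apply/imsetP/imsetP=> -[x _ ->].
  by exists x.
have := gP (f x); case gfx: (g (f x)) => [y|]; last by rewrite imset_f.
by move=> fy; exists y; rewrite // inE fy gfx.
Qed.

Lemma spectrum2_ge_classes k3 k beta :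
  0 < q -> is_partition sigma r -> 1 < size sigma ->
  r + 1 <= smallest_part sigma + beta ->
  spectrum2 H beta k3 -> n <= k <= k3 -> spectrum2 H beta k.
Proof.
move=> q_gt0 sigP s_gt1 delta_ge [C [f [fP def_k3]]] /andP[le_nk le_kk3].
have [R [injR cardR]] := imset_representatives f.
(* The preference of nu for R matters: nu i is outside R only if R misses class i. *)
pose nu i : vertex n q := odflt (i, Ordinal q_gt0) [pick y in R | y.1 == i].
have nu1 i : (nu i).1 = i by rewrite /nu; case: pickP => //= y /andP[_ /eqP].
have nuR x : x \in R -> nu x.1 \in R.
  rewrite /nu; case: pickP => /= [y /andP[] //|noR Rx].
  by have := noR x; rewrite Rx eqxx.
pose N := nu @: setT.
have cardN : #|N| = n.
  by rewrite card_imset ?cardsT ?card_ord //; apply: can_inj nu1.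
have [||T [sNT sTR cardT]] := @intermediate_set _ N (R :|: N) k.
- exact: subsetUr.
- rewrite cardN le_nk (leq_trans le_kk3) // -def_k3 -cardR.
  by rewrite subset_leq_card ?subsetUl.
(* Vertices serve as colours. As [T] contains every [nu i], the image of [g] is exactly [T]. *)
pose g x := if x \in T then x else nu x.1.
have g1 x : (g x).1 = x.1 by rewrite /g; case: ifP.
exists (vertex n q), g; split; last first.
  rewrite -cardT; congr #|pred_of_set _|; apply/setP=> x.
  apply/imsetP/idP=> [[y _ ->]|Tx]; last by exists x; rewrite // /g Tx.
  rewrite /g; case: ifP => // _.
  by apply: (subsetP sNT); apply: imset_f.
have T_nu x : x \in T -> x \notin R -> x = nu x.1.
  move=> /(subsetP sTR); rewrite inE => /orP[->//|/imsetP[i _ ->]] _.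
  by rewrite nu1.
move=> K HK; apply/andP; split.
  have n_gt0 : 0 < n.
    rewrite lt0n; apply: contraL s_gt1 => /eqP n0.
    move: HK; rewrite inE => /andP[_ /perm_size <-].
    rewrite size_filter -leqNgt (leq_trans (count_size _ _)) //.
    by rewrite size_map -cardE card_ord n0.
  (* The vertex supplied here is arbitrary; it only yields some [x] in [K]. *)
  have [x Kx _] := edge_two_classes s_gt1 HK (Ordinal n_gt0, Ordinal q_gt0).
  have [y Ky yx] := edge_two_classes s_gt1 HK x.
  apply/card_gt1P; exists (g y), (g x); split; try exact: imset_f.
  by apply: contra_neq yx => gyx; rewrite -g1 gyx g1.
(* If [nu x.1] is outside [R], then [R] misses the class of [x], so [T] meets this class only in
   [nu x.1] and [g] is constant on it. *)
have [/exists_inP[x Kx nuxR]|] := boolP [exists x in K, nu x.1 \notin R].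
  apply: (@edge_mono_class_le _ g (nu x.1) beta K x) => // y.
  rewrite inE in_vclass /g => /andP[_ /eqP yx].
  case: ifP => [Ty|_]; last by rewrite yx.
  by rewrite -yx; apply: T_nu => //; apply: contra nuxR => /nuR; rewrite yx.
rewrite negb_exists_in => /forall_inP nuKR.
(* A vertex of [T] outside [R] equals [nu] of its class, but on the classes that [K] meets [nu] now
   lies in [R]. *)
have gR : {subset g @: K <= R}.
  move=> _ /imsetP[x Kx ->]; have := nuKR x Kx; rewrite negbK => Rnu.
  rewrite /g; case: ifP => // Tx; apply: contraLR Rnu => nRx.
  by rewrite -(T_nu x).
(* Since [g] preserves classes, [g @: K] has at most as many vertices in each class as [K]. *)
have [i|K' HK' sDK'] := @edge_cover K (g @: K) HK.
  rewrite (leq_trans _ (leq_imset_card g _)) // subset_leq_card //.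
  apply/subsetP=> _ /setIP[/imsetP[x Kx ->]]; rewrite in_vclass g1 => xi.
  by rewrite imset_f // inE Kx in_vclass.
rewrite -(@card_in_imset _ _ f); last first.
  by move=> x y /gR Rx /gR Ry; apply: injR.
have /andP[_] := fP K' HK'.
by apply: leq_trans; rewrite subset_leq_card ?imsetS.
Qed.

End SigmaHypergraph.

Theorem theorem4p5 (r : nat) (sigma : seq nat) (n q beta : nat)
    (r_gt0 : 0 < r) (sigma_part : is_partition sigma r)
    (n_gt0 : 0 < n) (q_gt0 : 0 < q)
    (s_ge2 : 2 <= num_parts sigma) (s_le_beta : num_parts sigma <= beta)
    (delta_ge : r + 1 <= smallest_part sigma + beta) :
  no_gaps (spectrum2 (sigma_hypergraph n r q sigma) beta).
Proof.
move=> [k1 [k2 [k3 [lt12 lt23 S1 S3 []]]]].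
have [le2n|/ltnW len2] := leqP k2 n.
  apply: spectrum2_le_classes q_gt0 sigma_part s_ge2 delta_ge S1 _.
  by rewrite ltnW.
apply: spectrum2_ge_classes q_gt0 sigma_part s_ge2 delta_ge S3 _.
by rewrite len2 ltnW.
Qed.
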